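(* Let $e,r\ge1$ be integers, let $T$ be the Greenberg-Hastings cellular automaton with $e$ excited and $r$ refractory states, and let $Z_\infty$ be the set of configurations on which pulse annihilation never ends. Then $T|_{Z_\infty}$ is topologically conjugate to the skew-product map $F\colon\mathcal Z\to\mathcal Z$ of coupled left and right shifts on $\mathcal Z=\Sigma_-^+\times\mathbb Z$: the map $$H\colon Z_\infty\to\mathcal Z,\qquad H(x)=(x^R,x^L,p_{\mathrm{mid}}(x)),$$ where $x=(x^R\,{}^{p}|\,x^L)$ is split at $p=p_{\mathrm{mid}}(x)$, is a bijection with inverse $H^{-1}((x^R,x^L,p))=(x^R\,{}^{p}|\,x^L)$, both $H$ and $H^{-1}$ are continuous, and $H\circ T|_{Z_\infty}=F\circ H$.
   Context: Cellular automaton: $\mathcal A=\{0,1,\dots,e+r\}$, $E=\{1,\dots,e\}$. $X=\mathcal A^{\mathbb Z}$ carries the product topology. For $x\in X$, $(Tx)_k=x_k+1$ if $1\le x_k\le e+r-1$; $(Tx)_k=0$ if $x_k=e+r$; if $x_k=0$, then $(Tx)_k=1$ when $x_{k-1}\in E$ or $x_{k+1}\in E$, and $(Tx)_k=0$ otherwise. Write $x_{[i,j]}$ for the restriction of $x$ to coordinates $i,\dots,j$ (with $i=-\infty$ or $j=\infty$ allowed). Sets $Z$ and $Z_\infty$: for $i,j\in\mathcal A$ put $a_{i,j}=1$ if $(i,j)=(0,0)$, or $j=i+1$ with $0\le i\le e+r-1$, or $(i,j)=(e+r,0)$; otherwise $a_{i,j}=0$. Let $S_R=\{x\in X: a_{x_i,x_{i-1}}=1\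 \forall i\in\mathbb Z\}$, $S_L=\{x\in X: a_{x_i,x_{i+1}}=1\ \forall i\in\mathbb Z\}$. For $p\in\mathbb Z$ let $S_{R,p}^-$ be the set of $x\in\mathcal A^{\mathbb Z_{\le p}}$ with $a_{x_i,x_{i-1}}=1$ for all $i\le p$, and $S_{L,p}^+$ the set of $x\in\mathcal A^{\mathbb Z_{\ge p}}$ with $a_{x_i,x_{i+1}}=1$ for all $i\ge p$. Let $S_L^R$ be the set of $x\in X\setminus(S_R\cup S_L)$ for which there is $p\in\mathbb Z$ with $x_{[-\infty,p]}\in S_{R,p}^-$ and $x_{[p+1,\infty]}\in S_{L,p+1}^+$; every such $p$ is called a separating position of $x$, and the set $I_{\mathrm{sp}}(x)$ of them is finite for $x\in S_L^R$. $Z$ is the set of $x\in X$ such that either $x\in S_R\cup S_L$, or $x\in S_L^R$ and, with $p=\max I_{\mathrm{sp}}(x)$, we have $x_{p+1}=x_p$ or ($x_{[-\infty,p]}\in S_{R,p}^-$ and $x_{[p,\infty]}\in S_{L,p}^+$). $Z_\infty$ is the set of $x\in Z\cap S_L^R$ such that for every $k\in\mathbb Z$ neither $x_{[-\infty,k]}$ nor $x_{[k,\infty]}$ is identically zero; it satisfies $T(Z_\infty)=Z_\infty$ and has the subspace topology. Middle separating position: for $x\in Z_\infty$, $I_{\mathrm{sp}}(x)$ is an integer interval $[p_-,p_+]$, and $p_{\mathrm{mid}}(x)=\lfloor (p_++p_-)/2\rfloor$. Gluing: for $x^R\in\mathcal A^{\mathbb Z_{\le0}}$, $x^L\in\mathcal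 A^{\mathbb Z_{>0}}$ and $p\in\mathbb Z$, $(x^R\,{}^p|\,x^L)\in X$ is the configuration with value $x^R_{j-p}$ at positions $j\le p$ and $x^L_{j-p}$ at positions $j>p$. For $x=(x^R\,{}^p|\,x^L)\in Z_\infty$ put $a(x)=p_{\mathrm{mid}}(Tx)-p$; in particular $a(x^R\,{}^0|\,x^L)=p_{\mathrm{mid}}(T(x^R\,{}^0|\,x^L))$. Phase space: $\Sigma_R^-=\{x\in\mathcal A^{\mathbb Z_{\le0}}: a_{x_i,x_{i-1}}=1\ \forall i\le 0\}$, $\Sigma_L^+=\{x\in\mathcal A^{\mathbb Z_{>0}}: a_{x_i,x_{i+1}}=1\ \forall i\geq 1\}$, and $\Sigma_-^+=(\Sigma_R^-\times\Sigma_L^+)\setminus\Sigma_*$, where $(x^R,x^L)\in\Sigma_*$ if $x=(x^R\,{}^0|\,x^L)$ does not lie in $Z_\infty$. (This is described as being precisely the case if $x\in S_L^R$ has a dislocation at the block $x_{[0,1]}=(x^R_0,x^L_1)$, i.e. a step size $x_1-x_0$ mod $e+r+1$ exceeding $1$ such that $x\notin Z$, or if $x\in S_L^R$ and $x_{[-\infty,k]}$ or $x_{[k',\infty]}$ is identically zero for some $k,k'\in\mathbb Z$.) $\Sigma_R^-$ and $\Sigma_L^+$ carry the cylinder topologies, and $\mathcal Z=\Sigma_-^+\times\mathbb Z$ the resulting natural topology ($\mathbb Z$ discrete). Skew product: the shift $\sigma_{R,-}$ maps $(\dots,x_{-2},x_{-1},x_0)$ to $(\dots,x_{-2},x_{-1})$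 (re-indexed to end at position $0$), and $\sigma_{L,+}$ maps $(x_1,x_2,x_3,\dots)$ to $(x_2,x_3,\dots)$ (re-indexed to start at position $1$); for $m<0$ the pseudo-inverse $\sigma_{R,-}^m$ appends $|m|$ zeros on the right and $\sigma_{L,+}^m$ prepends $|m|$ zeros on the left (again re-indexed). For $z=(x,p)\in\mathcal Z$ with $x=(x^R,x^L)\in\Sigma_-^+$, $$F(z)=(f(x),g_x(p)),$$ with base function $f\colon\Sigma_-^+\to\Sigma_-^+$, $$f(x)=\left(\sigma_{R,-}^{-\alpha+1}(x^R),\ \sigma_{L,+}^{\alpha+1}(x^L)\right),\qquad \alpha=a(x^R\,{}^0|\,x^L),$$ where $\sigma_{R,-}^{-\alpha+1}$ means $\sigma_{R,-}^{-\alpha}\circ\sigma_{R,-}$ and $\sigma_{L,+}^{\alpha+1}$ means $\sigma_{L,+}^{\alpha}\circ\sigma_{L,+}$, and with fibre function $g_x\colon\mathbb Z\to\mathbb Z$, $g_x(p)=p+a(x^R\,{}^0|\,x^L)$.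
   Formalization: The set Σ_* removed from the phase space also contains the pairs (x^R,x^L) whose gluing at 0 lies in Z_∞ but has middle separating position different from 0; without this H is not surjective. *)

(* Defs.v *)
(* MathComp / MathComp-Analysis *)
From HB Require Import structures.
From mathcomp Require Import all_boot all_order all_algebra.
From mathcomp Require Import all_classical all_reals all_analysis.
Set Implicit Arguments.
Unset Strict Implicit.
Unset Printing Implicit Defensive.
Import Order.TTheory GRing.Theory Num.Theory.
Local Open Scope classical_set_scope.
Local Open Scope ring_scope.

(** Integer half-lines. *)

Definition Zle (p : int) := {i : int | i <= p}.
Definition Zge (p : int) := {i : int | p <= i}.

Section GreenbergHastings.
Context {e r : nat}.

(** The alphabet is {0, ..., e + r}: 0 is the rest state, 1, ..., e are the
    excited states and e + 1, ..., e + r the refractory ones.  It is discrete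
    and all the configuration spaces below carry the product topology. *)

Definition state := discrete_topology 'I_(e + r).+1.

Definition stval (s : state) : nat := nat_of_ord (s : 'I_(e + r).+1).

Definition rest : state := (ord0 : 'I_(e + r).+1).

Definition excited (s : state) : bool := (1 <= stval s <= e)%N.

Definition config := {ptws int -> state}.
Definition configle (p : int) := {ptws Zle p -> state}.
Definition configge (p : int) := {ptws Zge p -> state}.

Definition GH (x : config) : config := fun k =>
  if stval (x k) == 0%N then
    if excited (x (k - 1)) || excited (x (k + 1)) then
      (inord 1 : 'I_(e + r).+1)
    else rest
  else if (stval (x k) < e + r)%N then
    (inord (stval (x k)).+1 : 'I_(e + r).+1)
  else rest.

(** The transition matrix [a_{i,j}], as a boolean relation. *)
Definition trans (s t : state) : bool :=
  [|| (stval s == 0%N) && (stval t == 0%N),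
      stval t == (stval s).+1 |
      (stval s == e + r)%N && (stval t == 0%N)].

Definition SR : set config := [set x | forall i, trans (x i) (x (i - 1))].
Definition SL : set config := [set x | forall i, trans (x i) (x (i + 1))].

Definition SRle (p : int) : set (configle p) :=
  [set x | forall i j : Zle p, val j = val i - 1 -> trans (x i) (x j)].
Definition SLge (p : int) : set (configge p) :=
  [set x | forall i j : Zge p, val j = val i + 1 -> trans (x i) (x j)].
Arguments SRle : clear implicits.
Arguments SLge : clear implicits.

Definition restrle (p : int) (x : config) : configle p := fun i => x (val i).
Definition restrge (p : int) (x : config) : configge p := fun i => x (val i).
Arguments restrle : clear implicits.
Arguments restrge : clear implicits.

Definition separating (x : config) (p : int) : Prop :=
  SRle _ (restrle p x) /\ SLge _ (restrge (p + 1) x).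

Definition SLR : set config :=
  [set x | ~ (SR `|` SL) x /\ exists p, separating x p].

Definition Isp (x : config) : set int := [set p | separating x p].

(** Greatest and least separating positions; [Isp x] is finite and nonempty
    for [x] in [SLR], and the default value 0 is irrelevant there. *)
Definition pmax (x : config) : int := xget 0 (Isp x `&` ubound (Isp x)).
Definition pmin (x : config) : int := xget 0 (Isp x `&` lbound (Isp x)).

(** [(_ %/ 2)%Z] is division rounded towards minus infinity. *)
Definition pmid (x : config) : int := ((pmax x + pmin x)%R %/ 2)%Z.

Definition Zset : set config :=
  [set x | (SR `|` SL) x \/
    (SLR x /\
     let p := pmax x in
     x (p + 1) = x p \/
     (SRle _ (restrle p x) /\ SLge _ (restrge p x)))].

Definition Zinf : set config :=
  [set x | [/\ Zset x, SLR x &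
    forall k : int,
      ~ (forall i : Zle k, restrle k x i = rest) /\
      ~ (forall i : Zge k, restrge k x i = rest)]].

(** One-sided sequences, indexed by the integers [<= 0] resp. [>= 1], and their
    extensions by the rest state to all of the integers. *)

Definition extle (xR : configle 0) (j : int) : state :=
  if insub j is Some i then xR i else rest.
Definition extge (xL : configge 1) (j : int) : state :=
  if insub j is Some i then xL i else rest.

(** The configuration [(xR ^p| xL)]. *)
Definition glue_config (xR : configle 0) (p : int) (xL : configge 1) : config :=
  fun j => if j <= p then extle xR (j - p) else extge xL (j - p).

(** The two halves of [x] cut at [p]: [x = glue_config (cutR p x) p (cutL p x)]. *)
Definition cutR (p : int) (x : config) : configle 0 := fun j => x (val j + p).
Definition cutL (p : int) (x : config) : configge 1 := fun j => x (val j + p).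

(** [shiftR m] and [shiftL m] are the [m]-th powers of the shifts deleting the
    symbol at position 0, resp. 1.  For [m < 0] they append, resp. prepend,
    [|m|] zeros, which are the values of [extle] and [extge] outside the
    half-line; for [m > 0], [shiftR (- m) (shiftR m x)] is in general not [x]. *)
Definition shiftR (m : int) (xR : configle 0) : configle 0 :=
  fun j => extle xR (val j - m).
Definition shiftL (m : int) (xL : configge 1) : configge 1 :=
  fun j => extge xL (val j + m).

(** Displacement of the middle separating position of the configuration
    [(xR ^p| xL)], cut at its middle separating position [p]. *)
Definition displ (xR : configle 0) (p : int) (xL : configge 1) : int :=
  pmid (GH (glue_config xR p xL)) - p.

(** Elements of [Zinf] are always cut at their middle separating position, so
    [Sigma_star] also contains the pairs for which [glue_config xR 0 xL] lies in
    [Zinf] but is cut at another separating position: if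
    [pmid (glue_config xR 0 xL)] is not 0, then no point of [Zinf] has [(xR, xL)] as
    its two halves around its middle separating position. *)
Definition Sigma_star : set (configle 0 * configge 1) :=
  [set x | ~ (Zinf (glue_config x.1 0 x.2) /\ pmid (glue_config x.1 0 x.2) = 0)].

Definition Sigma : set (configle 0 * configge 1) :=
  (SRle 0 `*` SLge 1) `\` Sigma_star.

Definition phase_type : Type :=
  (configle 0 * configge 1 * discrete_topology int)%type.

Definition phase_space : set phase_type := [set z | Sigma z.1].

Definition skew_base (x : configle 0 * configge 1) : configle 0 * configge 1 :=
  let alpha := displ x.1 0 x.2 in
  (shiftR (- alpha) (shiftR 1 x.1), shiftL alpha (shiftL 1 x.2)).

Definition skew_fibre (x : configle 0 * configge 1) (p : int) : int :=
  p + displ x.1 0 x.2.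

Definition skew_product (z : phase_type) : phase_type :=
  (skew_base z.1, skew_fibre z.1 z.2).

Definition Hmap (x : config) : phase_type :=
  (cutR (pmid x) x, cutL (pmid x) x, pmid x).

Definition Hinv (z : phase_type) : config := glue_config z.1.1 z.2 z.1.2.

End GreenbergHastings.

Arguments state : clear implicits.
Arguments config : clear implicits.
Arguments configle : clear implicits.
Arguments configge : clear implicits.
Arguments Zinf : clear implicits.
Arguments Sigma : clear implicits.
Arguments phase_type : clear implicits.
Arguments phase_space : clear implicits.
Arguments GH : clear implicits.
Arguments skew_product : clear implicits.
Arguments Hmap : clear implicits.
Arguments Hinv : clear implicits.

(* Main.v *)
Require Import Defs.
From HB Require Import structures.
From mathcomp Require Import all_boot all_order all_algebra.
From mathcomp Require Import all_classical all_reals all_analysis.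
From mathcomp Require Import zify.
Set Implicit Arguments.
Unset Strict Implicit.
Unset Printing Implicit Defensive.
Import Order.TTheory GRing.Theory Num.Theory.
Local Open Scope classical_set_scope.
Local Open Scope ring_scope.

(** A point of [Zinf] is a right-moving wave train and a left-moving one that
    meet at a block of equal symbols, the middle of which is [pmid x]. Hence
    [GH] acts as [x (i - 1)] for [i <= pmid x] and as [x (i + 1)] for
    [i > pmid x]. The block keeps its middle unless it passes from the last
    refractory state to rest, in which case it merges with the neighbouring
    intervals of rest; in particular the new configuration is at rest between
    the old and the new middle, which is what the zeros inserted by the
    pseudo-inverse shifts record. The block is determined by the symbols on it
    and next to it, so [pmid] is locally constant on [Zinf], and continuity
    reduces to that of coordinate maps. *)

(** * Extremal integers and continuity into a product *)

Lemma int_maximum (P : int -> Prop) (m i0 : int) :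
  P i0 -> (forall i, P i -> i <= m) -> exists i, P i /\ forall j, P j -> j <= i.
Proof.
move=> Pi0 Pm.
have ex : exists n : nat, `[< P (m - n%:Z) >].
  exists (absz (m - i0)); apply/asboolP.
  have -> : m - (absz (m - i0))%:Z = i0 by have := Pm _ Pi0; lia.
  exact: Pi0.
case: (ex_minnP ex) => n /asboolP Pn nmin.
exists (m - n%:Z); split=> // j Pj.
have lejm := Pm _ Pj.
have : (n <= absz (m - j))%N.
  apply: nmin; apply/asboolP.
  by have -> : m - (absz (m - j))%:Z = j by lia.
lia.
Qed.

Lemma int_minimum (P : int -> Prop) (m i0 : int) :
  P i0 -> (forall i, P i -> m <= i) -> exists i, P i /\ forall j, P j -> i <= j.
Proof.
move=> Pi0 Pm.
have [|i Pi|i [Pi imax]] := @int_maximum (P \o -%R) (- m) (- i0).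
- by rewrite /= opprK.
- by have := Pm _ Pi; lia.
- exists (- i); split=> // j Pj.
  by have := imax (- j); rewrite /= opprK => /(_ Pj); lia.
Qed.

Lemma continuous_ptws (T V : topologicalType) (I : Type)
    (f : T -> {ptws I -> V}) :
  (forall i, continuous (fun x => f x i)) -> continuous f.
Proof.
move=> fc x; apply/cvg_sup => i A [B [[C oC <-] Bfx] /filterS]; apply.
by apply: fc; apply: open_nbhs_nbhs; split.
Qed.

Section Configurations.
Context {e r : nat}.
Implicit Types (x y : config e r) (a b p i j k : int) (s : nat).

(** * Symbols, one-sided conditions and meeting blocks *)

Lemma stval_le (t : state e r) : (stval t <= e + r)%N.
Proof. by rewrite -ltnS /stval ltn_ord. Qed.

Lemma stval_inj : injective (@stval e r).
Proof. by move=> t u tu; apply: val_inj. Qed.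

Lemma stval0 (t : state e r) : stval t = 0%N -> t = rest.
Proof. by move=> t0; apply: stval_inj. Qed.

Lemma SRleP x p : SRle (restrle (p:=p) x) <->
  forall i j, i <= p -> j = i - 1 -> trans (x i) (x j).
Proof.
split=> [Rx i j ip ji|Rx i j /= ji]; last exact: Rx (valP i) ji.
have jp : j <= p by lia.
exact: (Rx (exist _ i ip) (exist _ j jp)).
Qed.

Lemma SLgeP x p : SLge (restrge (p:=p) x) <->
  forall i j, p <= i -> j = i + 1 -> trans (x i) (x j).
Proof.
split=> [Lx i j ip ji|Lx i j /= ji]; last exact: Lx (valP i) ji.
have jp : p <= j by lia.
exact: (Lx (exist _ i ip) (exist _ j jp)).
Qed.

Lemma pmax_eq x m :
  separating x m -> (forall p, separating x p -> p <= m) -> pmax x = m.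
Proof.
move=> xm mub; rewrite /pmax; case: xgetP => [y _ [xy yub]|/(_ m) []].
  by apply/eqP; rewrite eq_le mub //=; apply: yub.
by split.
Qed.

Lemma pmin_eq x m :
  separating x m -> (forall p, separating x p -> m <= p) -> pmin x = m.
Proof.
move=> xm mlb; rewrite /pmin; case: xgetP => [y _ [xy ylb]|/(_ m) []].
  by apply/eqP; rewrite eq_le mlb //= andbT; apply: ylb.
by split.
Qed.

(** The block [a + 1, ..., b] in state [s] where right-moving and left-moving
    pulses meet. The fields [core_left0] and [core_right0] make a block of rest
    maximal; outside rest its width is 1 or 2. *)
Record core x a b s : Prop := Core {
  core_lt : a < b;
  core_R : forall i j, i <= a + 1 -> j = i - 1 -> trans (x i) (x j);
  core_L : forall i j, b <= i -> j = i + 1 -> trans (x i) (x j);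
  core_const : forall i, a < i <= b -> stval (x i) = s;
  core_left0 : s = 0%N -> stval (x a) = 1%N;
  core_right0 : s = 0%N -> stval (x (b + 1)) = 1%N;
  core_width : s != 0%N -> b <= a + 2 }.

Definition unbounded_support x :=
  (forall k, exists2 i, i <= k & stval (x i) != 0%N) /\
  (forall k, exists2 i, k <= i & stval (x i) != 0%N).

Lemma core_le x a b s : core x a b s -> (s <= e + r)%N.
Proof.
case=> ab _ _ c _ _ _; rewrite -(c b) ?stval_le //; lia.
Qed.

(** The transition out of [a + 1] leaves a choice only for [s = 0], between rest and 1; [core_left0]
    settles it. *)
Lemma core_left x a b s : core x a b s ->
  stval (x a) = if (s < e + r)%N then s.+1 else 0%N.
Proof.
move=> c; have := core_le c; case: c => ab R _ c l _ _.
have := R (a + 1) a; rewrite /trans (c (a + 1)); last lia.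
have := stval_le (x a); case: ltnP; lia.
Qed.

Lemma core_right x a b s : core x a b s ->
  stval (x (b + 1)) = if (s < e + r)%N then s.+1 else 0%N.
Proof.
move=> c; have := core_le c; case: c => ab _ L c _ l _.
have := L b (b + 1); rewrite /trans (c b); last lia.
have := stval_le (x (b + 1)); case: ltnP; lia.
Qed.

Lemma Zinf_support x : Zinf e r x -> unbounded_support x.
Proof.
case=> _ _ h; split=> k; have [hl hr'] := h k; apply: contrapT => ne.
  apply: hl => i; apply: stval0; apply: contrapT => /eqP i0.
  by apply: ne; exists (val i) => //; exact: (valP i).
apply: hr' => i; apply: stval0; apply: contrapT => /eqP i0.
by apply: ne; exists (val i) => //; exact: (valP i).
Qed.

(** * Translating, cutting and gluing configurations *)

Definition translate p x : config e r := fun i => x (i + p).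

Lemma GH_translate p x : GH e r (translate p x) = translate p (GH e r x).
Proof.
apply: funext => k; rewrite /GH /translate.
have -> : k - 1 + p = k + p - 1 by lia.
by have -> : k + 1 + p = k + p + 1 by lia.
Qed.

Lemma core_translate p x a b s :
  core x a b s -> core (translate p x) (a - p) (b - p) s.
Proof.
case=> ab R L c l0 r0 w; rewrite /translate; split.
- lia.
- by move=> i j ? ?; apply: R; lia.
- by move=> i j ? ?; apply: L; lia.
- by move=> i ?; apply: c; lia.
- by rewrite subrK.
- by have -> : b - p + 1 + p = b + 1 by lia.
- by move=> /w; lia.
Qed.

Lemma extleE (xR : configle e r 0) (j : int) (j0 : j <= 0) :
  extle xR j = xR (exist _ j j0).
Proof. by rewrite /extle insubT. Qed.

Lemma extgeE (xL : configge e r 1) (j : int) (j1 : 1 <= j) :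
  extge xL j = xL (exist _ j j1).
Proof. by rewrite /extge insubT. Qed.

Lemma extle0 (xR : configle e r 0) (j : int) : 0 < j -> extle xR j = rest.
Proof. by move=> j0; rewrite /extle insubF //; lia. Qed.

Lemma extge0 (xL : configge e r 1) (j : int) : j < 1 -> extge xL j = rest.
Proof. by move=> j0; rewrite /extge insubF //; lia. Qed.

(** The gluing position [q] is independent of the cut [p] because [displ] and [Sigma_star] are used
    with gluing at 0, wherever the middle was. *)
Lemma glue_cut x p q :
  glue_config (cutR p x) q (cutL p x) = translate (p - q) x.
Proof.
apply: funext => j; rewrite /glue_config /translate; case: ifP => jp.
  rewrite extleE; first lia.
  by move=> ?; rewrite /cutR /=; congr (x _); lia.
rewrite extgeE; first lia.
by move=> ?; rewrite /cutL /=; congr (x _); lia.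
Qed.

Lemma glue_translate (xR : configle e r 0) p q (xL : configge e r 1) :
  translate p (glue_config xR q xL) = glue_config xR (q - p) xL.
Proof.
apply: funext => j; rewrite /glue_config /translate.
have -> : (j + p <= q) = (j <= q - p) by lia.
by have -> : j + p - q = j - (q - p) by lia.
Qed.

Lemma cutR_glue (xR : configle e r 0) p (xL : configge e r 1) :
  cutR p (glue_config xR p xL) = xR.
Proof.
apply: funext => -[j j0]; rewrite /cutR /glue_config /=.
rewrite ifT; last by lia.
rewrite addrK; exact: extleE.
Qed.

Lemma cutL_glue (xR : configle e r 0) p (xL : configge e r 1) :
  cutL p (glue_config xR p xL) = xL.
Proof.
apply: funext => -[j j1]; rewrite /cutL /glue_config /=.
rewrite ifF; last by lia.
rewrite addrK; exact: extgeE.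
Qed.

Lemma Hmap_Hinv (z : phase_type e r) :
  pmid (Hinv e r z) = z.2 -> Hmap e r (Hinv e r z) = z.
Proof. by case: z => [[xR xL] p] /= zp; rewrite /Hmap zp cutR_glue cutL_glue. Qed.

Lemma Hinv_Hmap x : Hinv e r (Hmap e r x) = x.
Proof.
rewrite /Hinv /Hmap /= glue_cut subrr.
by apply: funext => i; rewrite /translate addr0.
Qed.

(** * Continuity of cutting and gluing; finite windows *)

Lemma continuous_cutR p : continuous (@cutR e r p).
Proof. by apply: continuous_ptws => j; apply: proj_continuous. Qed.

Lemma continuous_cutL p : continuous (@cutL e r p).
Proof. by apply: continuous_ptws => j; apply: proj_continuous. Qed.

Lemma continuous_extle j : continuous (fun xR : configle e r 0 => extle xR j).
Proof.
have [j0|j0] := lerP j 0.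
  have -> : (fun xR : configle e r 0 => extle xR j) = proj (exist _ j j0).
    by apply: funext => xR; rewrite extleE.
  exact: proj_continuous.
have -> : (fun xR : configle e r 0 => extle xR j) = fun=> rest.
  by apply: funext => xR; rewrite extle0.
exact: cst_continuous.
Qed.

Lemma continuous_extge j : continuous (fun xL : configge e r 1 => extge xL j).
Proof.
have [j0|j0] := lerP 1 j.
  have -> : (fun xL : configge e r 1 => extge xL j) = proj (exist _ j j0).
    by apply: funext => xL; rewrite extgeE.
  exact: proj_continuous.
have -> : (fun xL : configge e r 1 => extge xL j) = fun=> rest.
  by apply: funext => xL; rewrite extge0.
exact: cst_continuous.
Qed.

Lemma continuous_Hinv : continuous (Hinv e r).
Proof.
have fstC (U V : topologicalType) : continuous (@fst U V).
  by move=> [u v]; apply: cvg_fst.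
have sndC (U V : topologicalType) : continuous (@snd U V).
  by move=> [u v]; apply: cvg_snd.
apply: continuous_ptws => j z0.
(* The integer factor is discrete, so near [z0] the gluing position can be frozen. *)
have near_p : \forall z \near z0, z.2 = z0.2.
  exists (setT, [set z0.2]); last by case=> u p [_ ->].
  by split; [exact: filterT|exact: discrete_set1].
pose g (z : phase_type e r) : state e r := glue_config z.1.1 z0.2 z.1.2 j.
apply: (@cvg_trans _ (g @ z0)).
  by apply: near_eq_cvg; apply: filterS near_p => z zp; rewrite /g -zp.
rewrite /g /Hinv /glue_config; case: ifP => _.
  have c11 := continuous_comp (fstC _ _ z0) (fstC _ _ z0.1).
  exact: (continuous_comp c11 (@continuous_extle (j - z0.2) _)).
have c12 := continuous_comp (fstC _ _ z0) (sndC _ _ z0.1).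
exact: (continuous_comp c12 (@continuous_extge (j - z0.2) _)).
Qed.

Lemma near_agree x (l : nat) a :
  \forall y \near x, forall i, a <= i <= a + l%:Z -> x i = y i.
Proof.
have near1 i : \forall y \near x, y i = x i.
  exact: (@proj_continuous _ (fun=> state e r) i x [set x i] (discrete_set1 _)).
elim: l => [|l IH].
  apply: (@filterS _ _ (nbhs_filter x) _ _ _ (near1 a)) => y ya i ia.
  have -> : i = a by lia.
  exact: esym ya.
apply: (@filterS2 _ _ (nbhs_filter x) _ _ _ _ IH (near1 (a + l.+1%:Z))).
move=> y {}IH ya i ia.
have [->|ia'] := eqVneq i (a + l.+1%:Z); first exact: esym ya.
by apply: IH; lia.
Qed.

(** * Separating positions and the description of [Zinf] by blocks *)

Context (he : (1 <= e)%N) (hr : (1 <= r)%N).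

Lemma stval_GH x k : stval (GH e r x k) =
  if stval (x k) == 0%N then nat_of_bool (excited (x (k - 1)) || excited (x (k + 1)))
  else if (stval (x k) < e + r)%N then (stval (x k)).+1 else 0%N.
Proof.
rewrite /GH; case: ifP => _; first case: ifP => _ //.
  by rewrite /stval inordK //; lia.
by case: ifP => // ?; rewrite /stval inordK.
Qed.

(** As [2 <= e + r], no transition leads from the successor of [s] back to [s], which confines [p]
    to [[a, b]]. Transitions inside the block join equal symbols, possible only at rest; hence a
    block of width 2 outside rest separates only at [a + 1]. *)
Lemma core_separating x a b s p : core x a b s ->
  separating x p <-> a <= p <= b /\ [|| s == 0%N, b == a + 1 | p == a + 1].
Proof.
move=> cx; have xa := core_left cx; have xb := core_right cx.
have sN := core_le cx; case: cx => ab R L c l0 r0 w.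
rewrite /separating SRleP SLgeP; split=> [[Rp Lp]|[/andP[ap pb] h]].
  have := Rp (b + 1) b; have := Lp a (a + 1).
  have := Rp b (b - 1); have := Lp (a + 1) (a + 2).
  have cb := c b; have ca := c (a + 1).
  have cb' := c (b - 1); have ca' := c (a + 2).
  rewrite /trans xa xb; case: ltnP; lia.
split=> i j ip ji.
  have [ia|ia] := lerP i (a + 1); first exact: R.
  by rewrite /trans !c; lia.
have [ib|ib] := lerP b i; first exact: L.
by rewrite /trans !c; lia.
Qed.

Lemma core_pmax x a b s : core x a b s ->
  pmax x = if (s == 0%N) || (b == a + 1) then b else a + 1.
Proof.
move=> cx; have ab := core_lt cx; have w := core_width cx.
apply: pmax_eq => [|p] /=; rewrite (core_separating _ cx); case: ifP; lia.
Qed.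

Lemma core_pmin x a b s : core x a b s ->
  pmin x = if (s == 0%N) || (b == a + 1) then a else a + 1.
Proof.
move=> cx; have ab := core_lt cx; have w := core_width cx.
apply: pmin_eq => [|p] /=; rewrite (core_separating _ cx); case: ifP; lia.
Qed.

(** For width 2 outside rest [pmax x] and [pmin x] are both [a + 1], the exact midpoint of [a] and
    [b]; otherwise they are [b] and [a]. One formula thus serves all states. *)
Lemma core_pmid x a b s : core x a b s -> pmid x = ((a + b)%R %/ 2)%Z.
Proof.
move=> cx; have ab := core_lt cx; have w := core_width cx.
by rewrite /pmid (core_pmax cx) (core_pmin cx); case: ifP; lia.
Qed.

Lemma core_Zinf x a b s : core x a b s -> unbounded_support x -> Zinf e r x.
Proof.
move=> cx [tl tr]; have ab := core_lt cx; have w := core_width cx.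
have xa := core_left cx; have xb := core_right cx; have sN := core_le cx.
have xSLR : SLR x.
  split.
    move=> [/(_ (b + 1))|/(_ a)].
      rewrite addrK /trans xb (core_const cx (i := b)); last lia.
      case: ltnP; lia.
    rewrite /trans xa (core_const cx (i := a + 1)); last lia.
    case: ltnP; lia.
  exists (pmax x); rewrite (core_separating _ cx) (core_pmax cx).
  by case: ifP; lia.
split=> //.
- right; split=> //=.
  have sx : separating x (pmax x).
    by rewrite (core_separating _ cx) (core_pmax cx); case: ifP; lia.
  (* Either [pmax x = b], where both trains reach [b] itself, or the block has width 2 and its two
     equal symbols are those at [pmax x] and [pmax x + 1]. *)
  move: sx; rewrite (core_pmax cx); case: ifP => h [sR sL].
    by right; split=> //; rewrite SLgeP; apply: core_L cx.
  left; apply: stval_inj.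
  by rewrite !(core_const cx) //; lia.
- move=> k; split=> h0.
    have [i ik] := tl k; suff -> : x i = rest by [].
    exact: (h0 (exist _ i ik)).
  have [i ik] := tr k; suff -> : x i = rest by [].
  exact: (h0 (exist _ i ik)).
Qed.

(** The block is read off from the extreme separating positions [Q] and [P]: it is [P, P + 1] under
    the first alternative of [Zset] and [Q + 1, ..., P] under the second. *)
Lemma Zinf_core x : Zinf e r x -> exists a b s, core x a b s.
Proof.
case=> Zx [nRL [p0 sp0]] _.
case: Zx => [//|[_ /=]].
(* One failing transition of each kind bounds the separating positions above and below. *)
have [i0 Ri0] : exists i, ~ trans (x i) (x (i - 1)).
  by apply: contrapT => /forallNP h; apply: nRL; left=> i; apply: contrapT.
have [i1 Li1] : exists i, ~ trans (x i) (x (i + 1)).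
  by apply: contrapT => /forallNP h; apply: nRL; right=> i; apply: contrapT.
have [p|P [sP Pmax]] := @int_maximum (separating x) i0 p0 sp0.
  move=> [+ _]; rewrite SRleP => Rp; rewrite leNgt; apply/negP => pi0.
  by apply: Ri0; apply: Rp => //; lia.
have [p|Q [sQ Qmin]] := @int_minimum (separating x) (i1 - 1) p0 sp0.
  move=> [_]; rewrite SLgeP => Lp; rewrite leNgt; apply/negP => pi0.
  by apply: Li1; apply: Lp => //; lia.
rewrite (pmax_eq sP Pmax).
have sep p : (forall i j, i <= p -> j = i - 1 -> trans (x i) (x j)) ->
    (forall i j, p + 1 <= i -> j = i + 1 -> trans (x i) (x j)) ->
    separating x p.
  by move=> ? ?; split; rewrite ?SRleP ?SLgeP.
have [RP LP] : (forall i j, i <= P -> j = i - 1 -> trans (x i) (x j)) /\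
    (forall i j, P + 1 <= i -> j = i + 1 -> trans (x i) (x j)).
  by rewrite -SRleP -SLgeP.
have [RQ LQ] : (forall i j, i <= Q -> j = i - 1 -> trans (x i) (x j)) /\
    (forall i j, Q + 1 <= i -> j = i + 1 -> trans (x i) (x j)).
  by rewrite -SRleP -SLgeP.
have nRP : ~ trans (x (P + 1)) (x P).
  move=> h; suff /Pmax : separating x (P + 1) by lia.
  apply: sep => i j ip ji; last by apply: LP => //; lia.
  have [ip'|ip'] := lerP i P; first exact: RP.
  by have [-> ->] : i = P + 1 /\ j = P by lia.
have nLQ : ~ trans (x Q) (x (Q + 1)).
  move=> h; suff /Qmin : separating x (Q - 1) by lia.
  apply: sep => i j ip ji; first by apply: RQ => //; lia.
  have [ip'|ip'] := lerP (Q + 1) i; first exact: LQ.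
  by have [-> ->] : i = Q /\ j = Q + 1 by lia.
case=> [xP|[_]].
  exists (P - 1), (P + 1), (stval (x P)).
  (* Two symbols at rest would admit the transition from [P + 1] to [P] that [nRP] excludes. *)
  have P0 : stval (x P) != 0%N by move: nRP; rewrite /trans xP; lia.
  split=> //; try lia.
  - by move=> i j iP; apply: RP; lia.
  - move=> i iP; have [->//|->] : i = P \/ i = P + 1 by lia.
    by rewrite xP.
rewrite SLgeP => LP'.
have QP : Q <= P - 1.
  by apply: Qmin; apply: sep => i j ip ji; [apply: RP|apply: LP']; lia.
(* Here neighbours are joined by transitions in both directions, which forces rest since
   [2 <= e + r]. *)
have z i : Q < i < P -> stval (x i) = 0%N /\ stval (x (i + 1)) = 0%N.
  move=> iQP; have := RP (i + 1) i; have := LQ i (i + 1); rewrite /trans.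
  have := stval_le (x i); have := stval_le (x (i + 1)); lia.
exists Q, P, (stval (x P)); split; try lia.
- by move=> i j iQ ji; apply: RP => //; lia.
- by move=> i j iP ji; apply: LP' => //; lia.
- move=> i iQP; have := z i; have := z (P - 1); rewrite subrK.
  have [->//|] := eqVneq i P; lia.
- move=> s0; have := RQ; have := RP (Q + 1) Q; have := z (Q + 1).
  move: nLQ; rewrite /trans.
  have [QP1|?] := eqVneq (Q + 1) P; first by rewrite QP1; lia.
  lia.
- move=> s0; move: nRP; have := LP' P (P + 1); rewrite /trans; lia.
- have := z (P - 1); rewrite subrK; lia.
Qed.

(** * One step of the automaton around the block *)

(** In the right-moving train the left neighbour is the successor state, or both symbols are at
    rest. A 1 on the left excites a rest symbol since [1 <= e]. If both are at rest, then [i <= a]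
    and [x (i + 1)] is 0 or [e + r], not excited since [1 <= r]. *)
Lemma GH_left x a b s i : core x a b s -> i <= a + 1 -> GH e r x i = x (i - 1).
Proof.
move=> cx ia; have xa := core_left cx; have sN := core_le cx.
case: cx => ab R L c l0 r0 w.
apply: stval_inj; rewrite stval_GH /excited.
have := R i (i - 1); have := R (i + 1) i; rewrite /trans.
have := stval_le (x (i - 1)).
have [ia1|ia1] := eqVneq i (a + 1); last by case: ifP; last case: ifP; lia.
rewrite ia1 addrK xa (c (a + 1)); last lia.
case: (ltnP s (e + r)) => ?; case: ifP; lia.
Qed.

Lemma GH_right x a b s i : core x a b s -> b <= i -> GH e r x i = x (i + 1).
Proof.
move=> cx ib; have xb := core_right cx; have sN := core_le cx.
case: cx => ab R L c l0 r0 w.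
apply: stval_inj; rewrite stval_GH /excited.
have := L i (i + 1); have := L (i - 1) i; rewrite /trans.
have := stval_le (x (i + 1)).
have [ib1|ib1] := eqVneq i b; last by case: ifP; last case: ifP; lia.
rewrite ib1 xb (c b); last lia.
case: (ltnP s (e + r)) => ?; case: ifP; lia.
Qed.

Lemma GH_mid x a b s i : core x a b s -> a + 1 < i < b ->
  stval (x i) = 0%N /\ stval (GH e r x i) = 0%N.
Proof.
case=> ab R L c l0 r0 w iab.
have s0 : s = 0%N by lia.
rewrite {}s0 in c.
by rewrite stval_GH /excited (c i) ?(c (i + 1)) ?(c (i - 1)) //; lia.
Qed.

(** Only a block wider than 2 has positions beyond [a + 1] up to its middle; they are at rest before
    and after the step. *)
Lemma GH_le_pmid x a b s i : core x a b s -> i <= pmid x ->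
  GH e r x i = x (i - 1).
Proof.
move=> cx; rewrite (core_pmid cx) => im; have ab := core_lt cx.
have [ia|ia] := lerP i (a + 1); first exact: GH_left cx ia.
have [|_ y0] := GH_mid cx (i := i); first lia.
apply: stval_inj; rewrite y0 (core_const cx); last lia.
by have := core_width cx; lia.
Qed.

Lemma GH_gt_pmid x a b s i : core x a b s -> pmid x < i ->
  GH e r x i = x (i + 1).
Proof.
move=> cx; rewrite (core_pmid cx) => im; have ab := core_lt cx.
have [ib|ib] := lerP b i; first exact: GH_right cx ib.
have [|_ y0] := GH_mid cx (i := i); first lia.
apply: stval_inj; rewrite y0 (core_const cx); last lia.
by have := core_width cx; lia.
Qed.

(** Every position of a block of width at most 2 is an end of it and takes the state [s.+1] of its
    outer neighbour, so the block stays in place. *)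
Lemma GH_core_narrow x a b s : core x a b s -> (s < e + r)%N -> b <= a + 2 ->
  core (GH e r x) a b s.+1.
Proof.
move=> cx sN ba; have ab := core_lt cx.
split=> //.
- move=> i j ia ji; rewrite !(GH_left cx) //; try lia.
  by apply: (core_R cx); lia.
- move=> i j ib ji; rewrite !(GH_right cx) //; try lia.
  by apply: (core_L cx); lia.
- move=> i iab; have [ia|ib] : i = a + 1 \/ i = b by lia.
    by rewrite ia (GH_left cx) // addrK (core_left cx) sN.
  by rewrite ib (GH_right cx) // (core_right cx) sN.
Qed.

(** The two ends of the rest block are excited by the adjacent 1s; the block shrinks symmetrically
    and keeps its middle. *)
Lemma GH_core_wide x a b : core x a b 0 -> a + 2 < b ->
  core (GH e r x) (a + 1) (b - 1) 0.
Proof.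
move=> cx ab.
have ya : stval (GH e r x (a + 1)) = 1%N.
  by rewrite (GH_left cx) // addrK (core_left0 cx).
have yb : stval (GH e r x (b - 1 + 1)) = 1%N.
  by rewrite subrK (GH_right cx) // (core_right0 cx).
split=> //; try lia.
- move=> i j ia ji; have [iE|iE] := eqVneq i (a + 2).
    have [-> ->] : i = a + 2 /\ j = a + 1 by lia.
    by rewrite /trans ya; have [|_ ->] := GH_mid cx (i := a + 2); lia.
  rewrite !(GH_left cx) //; try lia.
  by apply: (core_R cx); lia.
- move=> i j ib ji; have [iE|iE] := eqVneq i (b - 1).
    have [-> ->] : i = b - 1 /\ j = b - 1 + 1 by lia.
    by rewrite /trans yb; have [|_ ->] := GH_mid cx (i := b - 1); lia.
  rewrite !(GH_right cx) //; try lia.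
  by apply: (core_L cx); lia.
- by move=> i iab; have [|_ ->] := GH_mid cx (i := i); lia.
Qed.

(** When the block is in state [e + r], the adjacent symbols are at rest, so
    that the new block absorbs the intervals of rest next to it: this is the
    only step in which the middle separating position can move. *)
Lemma GH_core_annihilate x a b : core x a b (e + r) -> unbounded_support x ->
  exists a' b', [/\ a' <= a, b <= b' & core (GH e r x) a' b' 0].
Proof.
move=> cx [tl tr]; have ab := core_lt cx; have w := core_width cx.
have xa := core_left cx; have xb := core_right cx; rewrite ltnn in xa xb.
have [i1 i1a xi1] := tl a; have [j1 j1b xj1] := tr (b + 1).
(* The nearest symbols outside rest on either side, at [i] and [j]; they exist because the support
   is unbounded both ways. *)
have [//|? []//|i [[ia xi] imax]] :=
  @int_maximum (fun i => i <= a /\ stval (x i) != 0%N) a i1.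
have [//|? []//|j [[jb xj] jmin]] :=
  @int_minimum (fun i => b + 1 <= i /\ stval (x i) != 0%N) (b + 1) j1.
have zl k : i < k <= a -> stval (x k) = 0%N.
  move=> ik; apply/eqP; apply: contraT => k0.
  have : k <= i by apply: imax; split=> //; lia.
  lia.
have zr k : b + 1 <= k < j -> stval (x k) = 0%N.
  move=> ik; apply/eqP; apply: contraT => k0.
  have : j <= k by apply: jmin; split=> //; lia.
  lia.
have {}ia : i < a.
  by rewrite lt_neqAle ia andbT; apply: contra xi => /eqP ->; rewrite xa.
have {}jb : b + 1 < j.
  by rewrite lt_neqAle jb andbT; apply: contra xj => /eqP <-; rewrite xb.
have xi1' : stval (x i) = 1%N.
  have := core_R cx (i := i + 1) (j := i); rewrite /trans zl; lia.
have xj1' : stval (x j) = 1%N.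
  have := core_L cx (i := j - 1) (j := j); rewrite /trans zr; lia.
(* The 1s at [i] and [j] move to [i + 1] and [j - 1], which must be [a'] and [b' + 1]. *)
exists (i + 1), (j - 2); split; try lia.
split; try lia.
- move=> k l ki lk; rewrite !(GH_left cx) //; try lia.
  by apply: (core_R cx); lia.
- move=> k l ki lk; rewrite !(GH_right cx) //; try lia.
  by apply: (core_L cx); lia.
- move=> k kij; have [ka|ka] := lerP k (a + 1).
    by rewrite (GH_left cx) // zl //; lia.
  by rewrite (GH_right cx) ?zr //; lia.
- by move=> _; rewrite (GH_left cx) ?addrK //; lia.
- move=> _; rewrite (GH_right cx); last lia.
  by have -> : j - 2 + 1 + 1 = j by lia.
Qed.

Lemma GH_support x : Zinf e r x -> unbounded_support (GH e r x).
Proof.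
move=> Zx; have [a [b [s cx]]] := Zinf_core Zx; have [tl tr] := Zinf_support Zx.
split=> k.
  have [i ik xi] := tl (Num.min (pmid x) k - 1).
  exists (i + 1); first lia.
  by rewrite (GH_le_pmid cx) ?addrK //; lia.
have [i ik xi] := tr (Num.max (pmid x) k + 2).
exists (i - 1); first lia.
by rewrite (GH_gt_pmid cx) ?subrK //; lia.
Qed.

(** The middle is fixed, and the range in the second claim empty, unless [s = e + r]; then the new
    rest block contains the old one, so everything between the two middles is at rest. *)
Lemma GH_core x : Zinf e r x ->
  (exists a b s, core (GH e r x) a b s) /\
  (forall i, Num.min (pmid x) (pmid (GH e r x)) < i ->
     i <= Num.max (pmid x) (pmid (GH e r x)) -> GH e r x i = rest).
Proof.
move=> Zx; have [a [b [s cx]]] := Zinf_core Zx; have ab := core_lt cx.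
have m := core_pmid cx.
have [sN|sN] := ltnP s (e + r).
  have [ba|ba] := lerP b (a + 2).
    have cy := GH_core_narrow cx sN ba; split; first by exists a, b, s.+1.
    by move=> i; rewrite (core_pmid cy) m; lia.
  have s0 : s = 0%N by have := core_width cx; lia.
  rewrite s0 in cx; have cy := GH_core_wide cx ba.
  split; first by exists (a + 1), (b - 1), 0%N.
  by move=> i; rewrite (core_pmid cy) m; lia.
have sE : s = (e + r)%N by have := core_le cx; lia.
rewrite sE in cx.
have [a' [b' [aa bb cy]]] := GH_core_annihilate cx (Zinf_support Zx).
split; first by exists a', b', 0%N.
move=> i; rewrite (core_pmid cy) m => i1 i2.
by apply: stval0; apply: (core_const cy); lia.
Qed.

Lemma GH_Zinf x : Zinf e r x -> Zinf e r (GH e r x).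
Proof.
move=> Zx; have [[a [b [s cy]]] _] := GH_core Zx.
exact: core_Zinf cy (GH_support Zx).
Qed.

(** * Locality and translation of the block *)

(** The window forces the two blocks to overlap. If an end differed, the symbol just outside one
    block would lie inside the other and equal its neighbour, but it is the successor of that
    neighbour. *)
Lemma core_local x y a b s a' b' s' : core x a b s -> core y a' b' s' ->
  (forall i, a <= i <= b + 1 -> x i = y i) -> a = a' /\ b = b'.
Proof.
move=> cx cy xy; have xa := core_left cx; have xb := core_right cx.
have ya := core_left cy; have yb := core_right cy.
have sN := core_le cx; have sN' := core_le cy.
have ab := core_lt cx; have ab' := core_lt cy.
have xc i : a < i <= b -> stval (y i) = s.
  by move=> ?; rewrite -xy ?(core_const cx) //; lia.
rewrite xy in xa; last lia.
rewrite xy in xb; last lia.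
have nxt u : (u <= e + r)%N -> (if (u < e + r)%N then u.+1 else 0%N) != u.
  by move=> uN; case: ifP; lia.
have a'b : a' < b.
  rewrite ltNge; apply/negP => ba.
  have := core_R cy (i := b + 1) (j := b).
  rewrite /trans xb xc; last lia.
  case: ltnP; lia.
have ab'' : a < b'.
  rewrite ltNge; apply/negP => ba.
  have := core_L cy (i := a) (j := a + 1).
  rewrite /trans xa xc; last lia.
  case: ltnP; lia.
split; apply/eqP; rewrite eq_le !leNgt; apply/andP; split; apply/negP => h.
- have := nxt s sN; rewrite -xa.
  rewrite (core_const cy (i := a)); last lia.
  by rewrite -(xc (a + 1)) ?(core_const cy) ?eqxx //; lia.
- have := nxt s' sN'; rewrite -ya.
  rewrite (xc a'); last lia.
  by rewrite -(core_const cy (i := a' + 1)) ?(xc (a' + 1)) ?eqxx //; lia.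
- have := nxt s' sN'; rewrite -yb.
  rewrite (xc (b' + 1)); last lia.
  by rewrite -(core_const cy (i := b')) ?(xc b') ?eqxx //; lia.
- have := nxt s sN; rewrite -xb.
  rewrite (core_const cy (i := b + 1)); last lia.
  by rewrite -(xc b) ?(core_const cy) ?eqxx //; lia.
Qed.

Lemma Zinf_translate p x : Zinf e r x -> Zinf e r (translate p x).
Proof.
move=> Zx; have [a [b [s cx]]] := Zinf_core Zx; have [tl tr] := Zinf_support Zx.
apply: core_Zinf (core_translate p cx) _; split=> k.
  have [i ik xi] := tl (k + p).
  by exists (i - p); [lia|rewrite /translate subrK].
have [i ik xi] := tr (k + p).
by exists (i - p); [lia|rewrite /translate subrK].
Qed.

Lemma pmid_translate p x : Zinf e r x -> pmid (translate p x) = pmid x - p.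
Proof.
move=> /Zinf_core[a [b [s cx]]].
rewrite (core_pmid cx) (core_pmid (core_translate p cx)); lia.
Qed.

(** * The two maps, the conjugacy and continuity of [Hmap] *)

(** [Sigma] only tests gluing at 0; gluing at [p] gives a translate, whose middle is translated
    along. *)
Lemma phase_space_Hinv (z : phase_type e r) : phase_space e r z ->
  Zinf e r (Hinv e r z) /\ pmid (Hinv e r z) = z.2.
Proof.
case: z => [[xR xL] p] [_ /contrapT[/= Z0 p0]]; rewrite /Hinv /=.
have -> : glue_config xR p xL = translate (- p) (glue_config xR 0 xL).
  by rewrite glue_translate; congr glue_config; lia.
split; first exact: Zinf_translate.
by rewrite pmid_translate // p0; lia.
Qed.

Lemma phase_space_Hmap x : Zinf e r x -> phase_space e r (Hmap e r x).
Proof.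
move=> Zx; have [a [b [s cx]]] := Zinf_core Zx.
have : separating x (pmid x).
  rewrite (core_separating _ cx) (core_pmid cx).
  by have := core_lt cx; have := core_width cx; lia.
rewrite /separating SRleP SLgeP => -[R L].
split.
  split=> [[i i0] [j j0]|[i i0] [j j0]] /= ji.
    by apply: R; rewrite /=; lia.
  by apply: L; rewrite /=; lia.
apply; rewrite /= glue_cut subr0; split; first exact: Zinf_translate.
by rewrite pmid_translate // subrr.
Qed.

Lemma Hmap_GH x : Zinf e r x ->
  Hmap e r (GH e r x) = skew_product e r (Hmap e r x).
Proof.
move=> Zx; have [a [b [s cx]]] := Zinf_core Zx; have [_ y0] := GH_core Zx.
have yl := fun i => GH_le_pmid (i := i) cx.
have yr := fun i => GH_gt_pmid (i := i) cx.
have d : displ (cutR (pmid x) x) 0 (cutL (pmid x) x)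
    = pmid (GH e r x) - pmid x.
  rewrite /displ glue_cut !subr0 GH_translate pmid_translate //.
  exact: GH_Zinf.
rewrite /skew_product /skew_fibre /skew_base /= d.
rewrite /Hmap; congr (_, _, _); last by lia.
- apply: funext => -[j j0]; rewrite {1}/cutR /shiftR /=.
  (* Up to the old middle both sides read [x] one place to the left. Beyond it the pseudo-inverse
     shift supplies zeros, matched by [y0]. *)
  have [jq|jq] := lerP (j + pmid (GH e r x)) (pmid x).
    rewrite yl // extleE; first lia.
    move=> ?; rewrite extleE /=; first lia.
    by move=> ?; rewrite /cutR /=; congr (x _); lia.
  by rewrite extle0 ?y0 //; lia.
- apply: funext => -[j j0]; rewrite {1}/cutL /shiftL /=.
  have [jq|jq] := lerP (j + pmid (GH e r x)) (pmid x).
    by rewrite extge0 ?y0 //; lia.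
  rewrite yr // extgeE; first lia.
  move=> ?; rewrite extgeE /=; first lia.
  by move=> ?; rewrite /cutL /=; congr (x _); lia.
Qed.

Lemma pmid_locally_constant x : Zinf e r x ->
  \forall y \near within (Zinf e r) (nbhs x), pmid y = pmid x.
Proof.
move=> Zx; have [a [b [s cx]]] := Zinf_core Zx.
have := near_agree x (absz (b + 1 - a)%R) a.
apply: (@filterS _ _ (nbhs_filter x)) => y xy Zy; have [a' [b' [s' cy]]] := Zinf_core Zy.
rewrite (core_pmid cx) (core_pmid cy).
have [|-> ->//] := core_local cx cy.
by move=> i iab; apply: xy; have := core_lt cx; lia.
Qed.

Lemma continuous_Hmap : {within Zinf e r, continuous (Hmap e r)}.
Proof.
apply/subspace_continuousP => x Zx.
(* [g] is [Hmap] with the cut frozen at the middle of [x]; the two agree on [Zinf] near [x]. *)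
pose g y : phase_type e r := (cutR (pmid x) y, cutL (pmid x) y, pmid x).
apply: (@cvg_trans _ (g @ within (Zinf e r) (nbhs x))).
  apply: near_eq_cvg; have := pmid_locally_constant Zx.
  by apply: filterS => y yx; rewrite /from_subspace /g /Hmap yx.
apply: cvg_within_filter.
have cR := @continuous_cutR (pmid x) x.
have cL := @continuous_cutL (pmid x) x.
have cRL : (cutR (pmid x) y, cutL (pmid x) y) @[y --> x] -->
    (cutR (pmid x) x, cutL (pmid x) x) by exact: cvg_pair cR cL.
have cp : (pmid x : discrete_topology int) @[y --> x] -->
    (pmid x : discrete_topology int) by exact: cst_continuous.
exact: (cvg_pair cRL cp).
Qed.

End Configurations.

Theorem mainTheorem5 (e r : nat) (he : (1 <= e)%N) (hr : (1 <= r)%N) :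
  (set_fun (Zinf e r) (Zinf e r) (GH e r) /\
   set_fun (phase_space e r) (phase_space e r) (skew_product e r)) /\
  [/\ set_bij (Zinf e r) (phase_space e r) (Hmap e r),
      set_fun (phase_space e r) (Zinf e r) (Hinv e r) /\
      (forall x, Zinf e r x -> Hinv e r (Hmap e r x) = x) /\
      (forall z, phase_space e r z -> Hmap e r (Hinv e r z) = z),
      {within Zinf e r, continuous (Hmap e r)},
      {within phase_space e r, continuous (Hinv e r)} &
      forall x, Zinf e r x ->
        Hmap e r (GH e r x) = skew_product e r (Hmap e r x)].
Proof.
have ZK z : phase_space e r z -> Hmap e r (Hinv e r z) = z.
  by move=> /(phase_space_Hinv he hr)[_ zp]; exact: Hmap_Hinv zp.
split; split.
- by move=> x Zx; exact: (GH_Zinf he hr Zx).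
(* Invariance of the phase space is transported from that of [Zinf] through the conjugacy. *)
- move=> z Sz; have [Zx _] := phase_space_Hinv he hr Sz.
  rewrite -(ZK z Sz) -(Hmap_GH he hr Zx).
  exact: (phase_space_Hmap he hr (GH_Zinf he hr Zx)).
- split.
  + by move=> x Zx; exact: (phase_space_Hmap he hr Zx).
  + by move=> x y _ _ xy; rewrite -(Hinv_Hmap x) xy Hinv_Hmap.
  + move=> z Sz; exists (Hinv e r z); last exact: ZK.
    by have [] := phase_space_Hinv he hr Sz.
- split; first by move=> z /(phase_space_Hinv he hr)[].
  by split=> // x _; apply: Hinv_Hmap.
- exact: continuous_Hmap he hr.
- by apply: continuous_subspaceT; apply: continuous_Hinv.
- by move=> x Zx; exact: (Hmap_GH he hr Zx).
Qed.
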